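(* Let $C_3=\langle \sigma\mid \sigma^3=1\rangle$ be the cyclic group of order $3$, let $\tau:=\sigma^2$, and let $\varphi\colon C_3\to \mathrm{Pol}_3(C_3)$ be the universal unital cubic map. Then the group $\mathrm{Pol}_3(C_3)$ is isomorphic to the group $$\langle a,b \mid (ba)^3,\ (ab^{-1}a)^3,\ [ba,ab^{-1}a] \rangle,$$ where $a=\varphi(\sigma)$ and $b=\varphi(\tau)$ (that is, the assignment $a\mapsto\varphi(\sigma)$, $b\mapsto\varphi(\tau)$ defines an isomorphism from the group given by this presentation onto $\mathrm{Pol}_3(C_3)$). Moreover, the elements $a,b$ have infinite order, and the group $\mathrm{Pol}_3(C_3)$ contains a non-abelian free subgroup.
   Context: Polynomial maps: for groups $G,H$, a map $\varphi\colon G\to H$ and $k\in G$, the finite difference is the map $(\Delta_k\varphi)(g):=\varphi(kg)\varphi(g)^{-1}$, $g\in G$. A map $\varphi$ is polynomial of degree $-1$ if it is identically $1$. For $d\ge -1$, $\varphi$ is polynomial of degree $d+1$ if $\Delta_k\varphi$ is polynomial of degree $d$ for every $k\in G$. A map is cubic if it is polynomial of degree at most $3$, and unital if $\varphi(1)=1$. Universal group: $\mathrm{Pol}_3(C_3)$ together with the unital cubic map $\varphi\colon C_3\to \mathrm{Pol}_3(C_3)$ is characterized by the universal property that for every group $H$ and every unital cubic map $\alpha\colon C_3\to H$ there is a unique group homomorphism $\bar\alpha\colon \mathrm{Pol}_3(C_3)\to H$ with $\alpha=\bar\alpha\circ\varphi$. Notation: $[x,y]=xyx^{-1}y^{-1}$.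 *)

(* Defs.v *)
From HB Require Import structures.
#[warnings="-notation-overridden"]
From mathcomp Require Import all_boot all_fingroup.
From mathcomp Require Import boolp.

Set Implicit Arguments.
Unset Strict Implicit.
Unset Printing Implicit Defensive.

Local Open Scope group_scope.

(* The convention [x, y] = x y x^-1 y^-1; MathComp's [~ x, y] is instead
   x^-1 y^-1 x y. *)
Definition comm (G : groupType) (x y : G) : G := x * y * x^-1 * y^-1.

Definition infinite_order (G : groupType) (x : G) : Prop :=
  forall n : nat, (0 < n)%N -> x ^+ n <> 1.

Definition fdiff (G H : groupType) (k : G) (phi : G -> H) : G -> H :=
  fun g => phi (k * g) * (phi g)^-1.

(* The degree is shifted by one so as to be a natural number:
   [polynomial_lt n phi] says that phi is polynomial of degree n - 1, and the
   base case n = 0 is the degree -1 of the map identically 1. *)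
Fixpoint polynomial_lt (G H : groupType) (n : nat) (phi : G -> H) : Prop :=
  if n is m.+1 then forall k : G, polynomial_lt m (fdiff k phi)
  else forall g : G, phi g = 1.

(* Polynomial of some degree n - 1 <= 3. *)
Definition cubic (G H : groupType) (phi : G -> H) : Prop :=
  exists2 n : nat, (n <= 4)%N & polynomial_lt n phi.

Definition unital (G H : groupType) (phi : G -> H) : Prop := phi 1 = 1.

(* (P, phi) is Pol_3(G) together with its universal unital cubic map. *)
Definition universal_unital_cubic (G P : groupType) (phi : G -> P) : Prop :=
  [/\ unital phi, cubic phi &
    forall (H : groupType) (alpha : G -> H), unital alpha -> cubic alpha ->
      exists2 f : {multiplicative P -> H}, alpha =1 f \o phi &
        forall f' : {multiplicative P -> H}, alpha =1 f' \o phi -> f' =1 f].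

Section FreeGroup.
Variable X : choiceType.

(* The letter (x, true) stands for x and (x, false) for its inverse. *)
Definition letter : Type := (X * bool)%type.
Definition linv (l : letter) : letter := (l.1, ~~ l.2).

Fixpoint reduced (w : seq letter) : bool :=
  if w is l :: w' then
    (if w' is l' :: _ then l' != linv l else true) && reduced w'
  else true.

(* Left multiplication of a reduced word by a letter. *)
Definition push (l : letter) (w : seq letter) : seq letter :=
  if w is l' :: w' then if l' == linv l then w' else l :: w else [:: l].

Definition reduce (w : seq letter) : seq letter := foldr push [::] w.

Definition winv (w : seq letter) : seq letter := rev (map linv w).

Record free_group : Type := FreeGroup {
  fword :> seq letter;
  fword_reduced : reduced fword
}.

HB.instance Definition _ := [isSub for fword].
HB.instance Definition _ := [Choice of free_group by <:].

Lemma linvK : involutive linv.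
Proof. by case=> x b; rewrite /linv /= negbK. Qed.

Lemma push_reduced l w : reduced w -> reduced (push l w).
Proof.
case: w => [|l' w] //= /andP[h1 h2]; case: ifP => //= ->.
by rewrite h1 h2.
Qed.

Lemma foldr_push_reduced u w : reduced w -> reduced (foldr push w u).
Proof. by move=> hw; elim: u => //= l u; apply: push_reduced. Qed.

Lemma reduce_reduced w : reduced (reduce w).
Proof. exact: foldr_push_reduced. Qed.

Lemma reduce_id w : reduced w -> reduce w = w.
Proof.
elim: w => //= l w IH /andP[h1 h2]; rewrite IH //.
by case: w h1 {IH h2} => //= l' w /negbTE->.
Qed.

Lemma pushK l w : reduced w -> push (linv l) (push l w) = w.
Proof.
case: w => [|l' w] /=; first by rewrite linvK eqxx.
move=> /andP[h1 _]; case: (eqVneq l' (linv l)) => [e|_] /=; last first.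
  by rewrite linvK eqxx.
by rewrite -e; case: w h1 => //= l'' w /negbTE->.
Qed.

Lemma foldr_push_push l u w : reduced u -> reduced w ->
  foldr push w (push l u) = push l (foldr push w u).
Proof.
case: u => [|l' u] //= /andP[_ hu] hw; case: eqP => //= ->.
by have:= pushK (linv l) (foldr_push_reduced u hw); rewrite linvK.
Qed.

Lemma foldr_push_reduce u w : reduced w ->
  foldr push w (reduce u) = foldr push w u.
Proof.
move=> hw; elim: u => //= l u IH.
by rewrite foldr_push_push ?IH ?reduce_reduced.
Qed.

Definition fone : free_group := @FreeGroup [::] isT.
Definition fmul (u v : free_group) : free_group :=
  FreeGroup (reduce_reduced (u ++ v)).
Definition finv (u : free_group) : free_group :=
  FreeGroup (reduce_reduced (winv u)).
Definition fgen (x : X) : free_group := @FreeGroup [:: (x, true)] isT.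

Lemma reduce_cat u v : reduce (u ++ v) = foldr push (reduce v) u.
Proof. exact: foldr_cat. Qed.

Lemma fmulA : associative fmul.
Proof.
move=> u v w; apply: val_inj.
rewrite /= [LHS]reduce_cat [RHS]reduce_cat.
rewrite foldr_push_reduce ?reduce_reduced // foldr_cat -[in RHS]reduce_cat.
by rewrite (reduce_id (reduce_reduced _)).
Qed.

Lemma fmul1 : left_id fone fmul.
Proof. by move=> u; apply: val_inj; rewrite /= reduce_id ?fword_reduced. Qed.

Lemma fmul1r : right_id fone fmul.
Proof.
by move=> u; apply: val_inj; rewrite /= cats0 reduce_id ?fword_reduced.
Qed.

Lemma winv_reduce w : reduce (winv w ++ w) = [::].
Proof.
rewrite reduce_cat /winv; elim: w => //= l w IH.
by rewrite rev_cons -cats1 foldr_cat /= pushK ?reduce_reduced.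
Qed.

Lemma winvK : involutive winv.
Proof.
by move=> w; rewrite /winv map_rev revK -map_comp map_id_in // => l _ /=;
  rewrite linvK.
Qed.

Lemma fmulV : left_inverse fone finv fmul.
Proof.
move=> u; apply: val_inj; rewrite /= -[RHS](winv_reduce u).
by rewrite !reduce_cat foldr_push_reduce // reduce_reduced.
Qed.

Lemma fmulrV : right_inverse fone finv fmul.
Proof.
move=> u; apply: val_inj; rewrite /= -[RHS](winv_reduce (winv u)) winvK.
by rewrite !reduce_cat (reduce_id (reduce_reduced _)).
Qed.

HB.instance Definition _ :=
  isGroup.Build free_group fmulA fmul1 fmul1r fmulV fmulrV.
End FreeGroup.

Inductive normal_closure (G : groupType) (R : G -> Prop) : G -> Prop :=
| ncl_rel x : R x -> normal_closure R x
| ncl_one : normal_closure R 1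
| ncl_mul x y :
    normal_closure R x -> normal_closure R y -> normal_closure R (x * y)
| ncl_inv x : normal_closure R x -> normal_closure R x^-1
| ncl_conj g x : normal_closure R x -> normal_closure R (g * x * g^-1).

Section Quotient.
Variables (G : groupType) (R : G -> Prop).

Definition qrel (x y : G) : bool := `[< normal_closure R (x * y^-1) >].

Lemma qrel_refl : reflexive qrel.
Proof. by move=> x; apply/asboolP; rewrite mulgV; apply: ncl_one. Qed.

Lemma qrel_sym : symmetric qrel.
Proof.
suff h x y : qrel x y -> qrel y x by move=> x y; apply/idP/idP; apply: h.
by move=> /asboolP/ncl_inv; rewrite invgM invgK => ?; apply/asboolP.
Qed.

Lemma qrel_trans : transitive qrel.
Proof.
move=> y x z /asboolP h1 /asboolP h2; apply/asboolP.
by have := ncl_mul h1 h2; rewrite mulgA mulgVK.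
Qed.

Canonical qrel_equiv := EquivRel qrel qrel_refl qrel_sym qrel_trans.

Definition gquot : Type := {eq_quot qrel_equiv}%qT.
HB.instance Definition _ := Choice.on gquot.

Definition gproj (x : G) : gquot := (\pi_({eq_quot qrel_equiv}) x)%qT.
Definition grepr (x : gquot) : G :=
  generic_quotient.repr (x : {eq_quot qrel_equiv}%qT).

Lemma greprK : cancel grepr gproj.
Proof. by move=> x; apply: reprK. Qed.

Lemma gprojP x y : gproj x = gproj y <-> normal_closure R (x * y^-1).
Proof.
split=> [/eqmodP/asboolP //|h].
by apply/eqmodP/asboolP.
Qed.

Lemma grepr_gproj x : normal_closure R (grepr (gproj x) * x^-1).
Proof. by apply/gprojP; rewrite greprK. Qed.

Definition qone : gquot := gproj 1.
Definition qmul (x y : gquot) : gquot := gproj (grepr x * grepr y).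
Definition qinv (x : gquot) : gquot := gproj (grepr x)^-1.

Lemma qmulE x y : qmul (gproj x) (gproj y) = gproj (x * y).
Proof.
apply/gprojP; rewrite invgM.
have := ncl_mul (grepr_gproj x) (ncl_conj x (grepr_gproj y)).
by rewrite !mulgA mulgVK.
Qed.

Lemma qinvE x : qinv (gproj x) = gproj x^-1.
Proof.
apply/gprojP; rewrite invgK.
have := ncl_inv (ncl_conj x^-1 (grepr_gproj x)).
by rewrite invgK -!mulgA mulVg mulg1 invgM invgK.
Qed.

Lemma qmulA : associative qmul.
Proof.
move=> x y z; rewrite -(greprK x) -(greprK y) -(greprK z) !qmulE.
by rewrite mulgA.
Qed.

Lemma qmul1 : left_id qone qmul.
Proof. by move=> x; rewrite -(greprK x) qmulE mul1g. Qed.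

Lemma qmul1r : right_id qone qmul.
Proof. by move=> x; rewrite -(greprK x) qmulE mulg1. Qed.

Lemma qmulV : left_inverse qone qinv qmul.
Proof. by move=> x; rewrite -(greprK x) qinvE qmulE mulVg. Qed.

Lemma qmulrV : right_inverse qone qinv qmul.
Proof. by move=> x; rewrite -(greprK x) qinvE qmulE mulgV. Qed.

HB.instance Definition _ :=
  isGroup.Build gquot qmulA qmul1 qmul1r qmulV qmulrV.

Lemma gproj_isMul : {morph gproj : x y / x * y}.
Proof. by move=> x y; rewrite -qmulE. Qed.

HB.instance Definition _ := isMultiplicative.Build _ _ gproj gproj_isMul.
End Quotient.

(* The group < X | R >. *)
Definition presented (X : choiceType) (R : free_group X -> Prop) : groupType :=
  gquot R.

Definition pgen (X : choiceType) (R : free_group X -> Prop) (x : X) :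
  presented R := gproj R (fgen x).

(* A free subgroup is the image of an injective homomorphism from some F(X). *)
Definition contains_nonabelian_free (G : groupType) : Prop :=
  exists (X : choiceType) (f : {multiplicative free_group X -> G}),
    injective f /\ exists u v : free_group X, f u * f v <> f v * f u.

Inductive gens : Type := gen_a | gen_b.

Definition bool_of_gens (x : gens) : bool := if x is gen_a then true else false.
Definition gens_of_bool (x : bool) : gens := if x then gen_a else gen_b.
Lemma bool_of_gensK : cancel bool_of_gens gens_of_bool.
Proof. by case. Qed.
HB.instance Definition _ := Choice.copy gens (can_type bool_of_gensK).

(* < a, b | (ba)^3, (ab^-1a)^3, [ba, ab^-1a] > *)
Definition rels (r : free_group gens) : Prop :=
  let a := fgen gen_a in let b := fgen gen_b in
  [\/ r = (b * a) ^+ 3, r = (a * b^-1 * a) ^+ 3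
    | r = comm (b * a) (a * b^-1 * a)].

Section Lift.
Variables (X : choiceType) (H : groupType) (h : X -> H).

Definition leval (l : letter X) : H := if l.2 then h l.1 else (h l.1)^-1.
Definition weval (w : seq (letter X)) : H := foldr (fun l z => leval l * z) 1 w.
Definition flift (w : free_group X) : H := weval w.

Lemma weval_cat u v : weval (u ++ v) = weval u * weval v.
Proof. by elim: u => /= [|l u ->]; rewrite ?mul1g ?mulgA. Qed.

Lemma leval_inv l : leval (linv l) = (leval l)^-1.
Proof. by case: l => x [] //; rewrite /leval /= invgK. Qed.

Lemma weval_reduce w : weval (reduce w) = weval w.
Proof.
elim: w => //= l w <-; case: (reduce w) => //= l' w'.
by case: eqP => //= ->; rewrite leval_inv mulVKg.
Qed.

Lemma flift_isMul : {morph flift : x y / x * y}.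
Proof. by move=> u v; rewrite /flift weval_reduce weval_cat. Qed.

HB.instance Definition _ := isMultiplicative.Build _ _ flift flift_isMul.

Lemma flift_gen x : flift (fgen x) = h x.
Proof. exact: mulg1. Qed.
End Lift.

Lemma multiplicative1 (G H : groupType) (f : {multiplicative G -> H}) :
  f 1 = 1.
Proof. by apply: (mulIg (f 1)); rewrite -gmulfM !mul1g. Qed.

Lemma multiplicativeV (G H : groupType) (f : {multiplicative G -> H}) x :
  f x^-1 = (f x)^-1.
Proof.
by apply: (mulIg (f x)); rewrite -gmulfM !mulVg multiplicative1.
Qed.

Lemma free_group_ext (X : choiceType) (H : groupType)
    (f g : {multiplicative free_group X -> H}) :
  (forall x, f (fgen x) = g (fgen x)) -> f =1 g.
Proof.
move=> e [w hw]; elim: w hw => [|l w IH] hw.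
  by rewrite [FreeGroup _](_ : _ = 1) ?multiplicative1 //; apply: val_inj.
have hw' : reduced w by case/andP: hw.
have el : f (@FreeGroup X [:: l] isT) = g (@FreeGroup X [:: l] isT).
  case: l {hw} => x [|]; first exact: e.
  rewrite [FreeGroup _](_ : _ = (fgen x)^-1) ?multiplicativeV ?e //.
  exact: val_inj.
rewrite [FreeGroup _](_ : _ = @FreeGroup X [:: l] isT * FreeGroup hw').
  by rewrite !gmulfM el IH.
by apply: val_inj; rewrite -[LHS](reduce_id hw).
Qed.

Lemma eq_polynomial_lt (G H : groupType) n (phi psi : G -> H) :
  phi =1 psi -> polynomial_lt n phi -> polynomial_lt n psi.
Proof.
elim: n phi psi => [|n IH] phi psi e /= hphi; first by move=> g; rewrite -e.
by move=> k; apply: IH (hphi k) => g; rewrite /fdiff !e.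
Qed.

Lemma polynomial_lt_leq (G H : groupType) m n (phi : G -> H) :
  (m <= n)%N -> polynomial_lt m phi -> polynomial_lt n phi.
Proof.
elim: n m phi => [|n IH] [|m] phi //= le h k.
  by apply: (IH 0%N) => // g; rewrite /fdiff !h mulgV.
exact: IH (h k).
Qed.

Fixpoint fdiff_values (G H : groupType) n (phi : G -> H) (x : H) : Prop :=
  if n is m.+1 then exists k : G, fdiff_values m (fdiff k phi) x
  else exists g : G, x = phi g.

Lemma polynomial_lt_values (G H K : groupType) (f : {multiplicative H -> K})
    n (phi : G -> H) :
  polynomial_lt n (f \o phi) <->
  forall x, fdiff_values n phi x -> f x = 1.
Proof.
elim: n phi => [|n IH] phi /=.
  by split=> [h x [g ->]|h g]; [apply: h | apply: h; exists g].
have e k : fdiff k (f \o phi) =1 f \o fdiff k phi.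
  by move=> g; rewrite /fdiff /= gmulfM multiplicativeV.
split=> [h x [k hx]|h k].
  by apply: (proj1 (IH (fdiff k phi))) hx; apply: eq_polynomial_lt (h k).
apply: eq_polynomial_lt (fsym (e k)) _; apply/IH => x hx.
by apply: h; exists k.
Qed.

Section Existence.
Variable G : groupType.

Definition pol3_rels (r : free_group G) : Prop :=
  r = fgen 1 \/ fdiff_values 4 (@fgen G) r.

Lemma universal_unital_cubic_exists :
  exists (P : groupType) (phi : G -> P), universal_unital_cubic phi.
Proof.
exists (presented pol3_rels), (pgen pol3_rels).
have rel1 r : pol3_rels r -> gproj pol3_rels r = 1.
  by move=> hr; apply/gprojP; rewrite invg1 mulg1; apply: ncl_rel.
split; first by apply: rel1; left.
  exists 4 => //; apply/(@polynomial_lt_values _ _ _ (gproj pol3_rels)).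
  by move=> x hx; apply: rel1; right.
move=> H alpha h1 [n le /(polynomial_lt_leq le) h4].
pose F : {multiplicative free_group G -> H} := flift alpha.
have Fgen x : F (fgen x) = alpha x by apply: flift_gen.
have Fker w : normal_closure pol3_rels w -> F w = 1.
  elim=> {w} [y [->|hy]||y z _ hy _ hz|y _ hy|g y _ hy].
  - by rewrite Fgen.
  - apply: (proj1 (polynomial_lt_values F 4 (@fgen G))) hy.
    by apply: eq_polynomial_lt h4 => g; rewrite /= Fgen.
  - exact: multiplicative1.
  - by rewrite gmulfM hy hz mulg1.
  - by rewrite multiplicativeV hy invg1.
  - by rewrite !gmulfM multiplicativeV hy mulg1 mulgV.
pose f (x : presented pol3_rels) : H := F (grepr x).
have fE x : f (gproj pol3_rels x) = F x.
  have := Fker _ (grepr_gproj pol3_rels x).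
  by rewrite gmulfM multiplicativeV => /divg1_eq.
have fM : {morph f : x y / x * y}.
  move=> x y; rewrite -(greprK x) -(greprK y) -gmulfM.
  by rewrite !fE gmulfM.
pose fm := HB.pack_for {multiplicative presented pol3_rels -> H} f
  (isMultiplicative.Build _ _ f fM).
exists fm => [x|f' hf' x]; first by rewrite /= fE Fgen.
have hf'' w : f' (gproj pol3_rels w) = F w.
  pose f'' : {multiplicative free_group G -> H} :=
    HB.pack_for {multiplicative free_group G -> H}
      (f' \o gproj pol3_rels)
      (isMultiplicative.Build _ _ _ (comp_gmulfM f' (gproj pol3_rels))).
  by apply: (@free_group_ext _ _ f'' F) => y; rewrite Fgen hf'.
by rewrite /= -(greprK x) fE hf''.
Qed.
End Existence.

(* Main.v *)
(* Put u = b a and v = a b^-1 a, so that b = u a^-1 and v = a^2 u^-1 a. A unital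
   map C3 -> H is cubic iff its two second differences
     D_sigma D_sigma phi = a (v^-1, u^-1 v, u) a^-1 (pointwise conjugate) and
     D_sigma D_tau phi = (u^-1, v, u v^-1)
   are affine, i.e. multiplied by a constant when the argument is shifted by
   sigma. The first condition gives u^-1 v^2 u = v^-1 and the second one
   u^-1 v u = v^-2; hence v^3 = 1, then [u, v] = 1 and u^3 = 1. So both universal
   properties agree.
   The presented group is <C3 x C3, a | a a u^-1 a v^-1>. It acts on a triangle
   complex with one orbit of vertices, of edges and of triangles, vertex
   stabiliser <u, v> = C3 x C3, and links equal to the Pappus graph, which has
   girth 6. This nonpositive curvature makes the following string rewriting
   system complete: shorten a path running along two sides of a triangle, and
   flip an a^-1 ... a path across a pair of triangles sharing an edge. The words
   (a^-1 u v)^n and all reduced words in p = a u and q = u v a v are in normal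
   form, so p and q generate a free group, and a has infinite order because
   a^6 = v (a^-1 u v)^3 v^-1. Exchanging sigma and tau handles b. *)

Require Import Defs.
From HB Require Import structures.
From mathcomp Require Import all_boot all_fingroup.
From mathcomp Require Import ssralg zmodp cyclic.

Set Implicit Arguments.
Unset Strict Implicit.
Unset Printing Implicit Defensive.

Local Open Scope group_scope.

(** * String rewriting: critical pairs, normal forms and confluence *)

Section StringRewriting.
Local Open Scope nat_scope.
Variables (L : eqType) (rules : seq (seq L * seq L)).

Inductive red : seq L -> seq L -> Prop :=
| red_refl w : red w w
| red_step x r y w :
    r \in rules -> red (x ++ r.2 ++ y) w -> red (x ++ r.1 ++ y) w.

Definition joinable (w1 w2 : seq L) : Prop :=
  exists2 w, red w1 w & red w2 w.

Definition irreducible_word (w : seq L) : Prop := forall w', red w w' -> w' = w.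

Lemma red_trans w1 w2 w3 : red w1 w2 -> red w2 w3 -> red w1 w3.
Proof. by elim=> // x r y w hr _ IH /IH; apply: red_step. Qed.

Lemma red_inv w1 w2 : red w1 w2 ->
  w1 = w2 \/ exists x r y,
    [/\ r \in rules, w1 = x ++ r.1 ++ y & red (x ++ r.2 ++ y) w2].
Proof.
by case=> [w|x r y w hr h]; [left | right; exists x, r, y].
Qed.

Lemma red_rule r : r \in rules -> red r.1 r.2.
Proof.
move=> hr; have := @red_step [::] r [::] r.2 hr; rewrite /= !cats0; apply.
exact: red_refl.
Qed.

Lemma red_ctx x y w1 w2 : red w1 w2 -> red (x ++ w1 ++ y) (x ++ w2 ++ y).
Proof.
elim=> [w|x' r y' w hr _]; first exact: red_refl.
by rewrite -!catA !(catA x); apply: red_step.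
Qed.

Lemma joinable_sym w1 w2 : joinable w1 w2 -> joinable w2 w1.
Proof. by case=> w h1 h2; exists w. Qed.

Lemma joinable_refl w : joinable w w.
Proof. by exists w; apply: red_refl. Qed.

Lemma joinable_red w1 w2 : red w1 w2 -> joinable w1 w2.
Proof. by exists w2; last apply: red_refl. Qed.

Lemma joinable_ctx x y w1 w2 :
  joinable w1 w2 -> joinable (x ++ w1 ++ y) (x ++ w2 ++ y).
Proof. by case=> w h1 h2; exists (x ++ w ++ y); apply: red_ctx. Qed.

Fixpoint rewrite_once (w : seq L) : seq L :=
  if w is l :: w' then
    if [seq r <- rules | prefix r.1 w] is r :: _ then
      r.2 ++ drop (size r.1) w
    else l :: rewrite_once w'
  else [::].

(** [n] is fuel: agreement after [n] steps proves joinability, normal form or not. *)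
Definition normalize (n : nat) : seq L -> seq L := iter n rewrite_once.

Lemma red_rewrite_once w : red w (rewrite_once w).
Proof.
elim: w => [|l w IH]; first exact: red_refl.
rewrite [rewrite_once _]/=; case E: [seq r <- _ | _] => [|r s].
  by have := red_ctx [:: l] [::] IH; rewrite !cats0.
have: r \in [seq r <- rules | prefix r.1 (l :: w)] by rewrite E mem_head.
rewrite mem_filter => /andP[/prefixP[y ->] hr].
rewrite drop_size_cat //.
exact: (red_ctx [::] y (red_rule hr)).
Qed.

Lemma red_normalize n w : red w (normalize n w).
Proof.
elim: n => [|n IH] /=; first exact: red_refl.
exact: red_trans IH (red_rewrite_once _).
Qed.

Lemma joinable_normalize n w1 w2 :
  normalize n w1 == normalize n w2 -> joinable w1 w2.
Proof.
move=> /eqP e; exists (normalize n w1); first exact: red_normalize.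
by rewrite e; apply: red_normalize.
Qed.

(** At offset [i] of [r1.1], the first test covers an [r2.1] reaching at least to its end, the
    second an [r2.1] lying inside it. *)
Definition critical_pairs_ok (n : nat) (r1 r2 : seq L * seq L) : bool :=
  all (fun i =>
    let c := take i r1.1 in let e := drop i r1.1 in
    (if prefix e r2.1 then
       normalize n (r1.2 ++ drop (size e) r2.1) == normalize n (c ++ r2.2)
     else true)
    && (if prefix r2.1 e then
       normalize n r1.2 == normalize n (c ++ r2.2 ++ drop (size r2.1) e)
     else true))
    (iota 0 (size r1.1)).

Definition locally_confluent (n : nat) : bool :=
  all (fun r1 => all (critical_pairs_ok n r1) rules) rules.

Lemma cat_eq_prefix (s1 s2 t1 t2 : seq L) : size s1 <= size t1 ->
  s1 ++ s2 = t1 ++ t2 -> exists2 d, t1 = s1 ++ d & s2 = d ++ t2.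
Proof.
elim: s1 t1 => [|l s1 IH] [|l' t1] //= le; first by exists [::].
  by exists (l' :: t1).
by case=> -> /(IH _ le)[d -> ->]; exists d.
Qed.

Lemma critical_pair_lemma n x1 r1 y1 x2 r2 y2 :
  locally_confluent n -> r1 \in rules -> r2 \in rules ->
  x1 ++ r1.1 ++ y1 = x2 ++ r2.1 ++ y2 ->
  joinable (x1 ++ r1.2 ++ y1) (x2 ++ r2.2 ++ y2).
Proof.
move=> lc.
wlog le : x1 r1 y1 x2 r2 y2 / size x1 <= size x2 => [wl|] h1 h2 e.
  case/orP: (leq_total (size x1) (size x2)) => le; first exact: wl.
  exact/joinable_sym/wl.
have [c -> {}e] := cat_eq_prefix le e.
rewrite -catA; case: (leqP (size r1.1) (size c)) => hc.
  (* Disjoint redexes: apply both rules. *)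
  have [d {e}-> ->] := cat_eq_prefix hc e; exists (x1 ++ r1.2 ++ d ++ r2.2 ++ y2).
    by have := red_ctx (x1 ++ r1.2 ++ d) y2 (red_rule h2); rewrite -!catA.
  by have := red_ctx x1 (d ++ r2.2 ++ y2) (red_rule h1); rewrite -!catA.
have [f ef ey] := cat_eq_prefix (ltnW hc) (esym e).
have ci : size c \in iota 0 (size r1.1) by rewrite mem_iota.
have /allP/(_ _ ci) := allP (allP lc _ h1) _ h2.
rewrite /= ef take_size_cat ?drop_size_cat // => /andP[ov ct].
case: (leqP (size f) (size r2.1)) => hf.
  have [g eg ->] := cat_eq_prefix hf (esym ey).
  move: ov; rewrite eg prefix_prefix drop_size_cat //= => /joinable_normalize.
  by move=> /(joinable_ctx x1 y2); rewrite -!catA.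
have [g eg ->] := cat_eq_prefix (ltnW hf) ey.
move: ct; rewrite eg prefix_prefix drop_size_cat //= => /joinable_normalize.
by move=> /(joinable_ctx x1 y1); rewrite -!catA.
Qed.

Variable k : nat.
Hypothesis lhs_size : all (fun r => 0 < size r.1 <= k) rules.

(** Only a window of [k] letters is inspected, so the check can compute on a word with an abstract
    tail. *)
Fixpoint is_irreducible (w : seq L) : bool :=
  if w is l :: w' then
    ~~ has (fun r => prefix r.1 (take k w)) rules && is_irreducible w'
  else true.

Lemma is_irreducibleP w : is_irreducible w -> irreducible_word w.
Proof.
move=> irr w' /red_inv[//|[x [r [y [hr e _]]]]].
have {irr e} : is_irreducible (r.1 ++ y).
  by rewrite {}e in irr; elim: x irr => //= l x IH /andP[_ /IH].
have /andP[] := allP lhs_size _ hr; case E: r.1 => [|l s] // _ le /andP[/hasP[]].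
exists r => //; rewrite E; apply/prefixP; exists (take (k - size (l :: s)) y).
by rewrite -cat_cons take_cat ltnNge le.
Qed.

Lemma joinable_irreducible w1 w2 :
  irreducible_word w1 -> irreducible_word w2 -> joinable w1 w2 -> w1 = w2.
Proof. by move=> i1 i2 [w /i1 <- /i2]. Qed.

Variable mu : seq L -> nat.
Hypothesis mu_decreasing :
  forall x r y, r \in rules -> mu (x ++ r.2 ++ y) < mu (x ++ r.1 ++ y).
Variable n : nat.
Hypothesis lc : locally_confluent n.

(** Newman's lemma, by induction on a bound for [mu w]. *)
Lemma confluent w w1 w2 : red w w1 -> red w w2 -> joinable w1 w2.
Proof.
move: {2}(mu w).+1 (ltnSn (mu w)) => m; elim: m w w1 w2 => // m IH w w1 w2 hw.
move=> p1 p2; case: (red_inv p1) (red_inv p2) hw => [<-|[x1 [r1 [y1 [h1 e1 q1]]]]].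
  by move=> _ _; apply: joinable_red.
case=> [<- _|[x2 [r2 [y2 [h2 e2 q2]]]]].
  exact/joinable_sym/joinable_red.
rewrite e1 ltnS => hw.
have [w3 s1 s2] := critical_pair_lemma lc h1 h2 (etrans (esym e1) e2).
have lt1 := leq_trans (mu_decreasing x1 y1 h1) hw.
have lt2 : mu (x2 ++ r2.2 ++ y2) < m.
  by apply: leq_trans (mu_decreasing x2 y2 h2) _; rewrite -e2 e1.
have [w4 t1 t3] := IH _ _ _ lt1 q1 s1.
have [w5 t5 t2] := IH _ _ _ lt2 (red_trans s2 t3) q2.
by exists w5; first apply: red_trans t1 t5.
Qed.

Lemma joinable_trans w1 w2 w3 :
  joinable w1 w2 -> joinable w2 w3 -> joinable w1 w3.
Proof.
case=> p a1 a2 [q b2 b3]; have [r c1 c2] := confluent a2 b2.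
by exists r; [apply: red_trans a1 c1 | apply: red_trans b3 c2].
Qed.

Lemma joinable_cat w1 w2 w1' w2' :
  joinable w1 w1' -> joinable w2 w2' -> joinable (w1 ++ w2) (w1' ++ w2').
Proof.
move=> /(joinable_ctx [::] w2) h1 /(joinable_ctx w1' [::]).
by rewrite !cats0; apply: joinable_trans.
Qed.
End StringRewriting.

(** * The rewriting system of the triangle complex *)

Section TriangleSystem.
Local Open Scope ring_scope.

Definition plane : Type := ('Z_3 * 'Z_3)%type.
(* inl (i, j) stands for u^i v^j, inr true for a and inr false for a^-1. *)
Definition sletter : Type := (plane + bool)%type.

Definition uvec : plane := (1, 0).
Definition vvec : plane := (0, 1).
Definition la : sletter := inr true.
Definition la' : sletter := inr false.
Definition opt (x : plane) : seq sletter :=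
  if x == 0 then [::] else [:: inl x].

Definition planes : seq plane :=
  [seq (i, j) | i <- [:: 0; 1; -1], j <- [:: 0; 1; -1]].

(* The triples (x, y, z) with a^-1 = x a y a z: the relation
   a a u^-1 a v^-1 = 1 read from each of its three occurrences of a. *)
Definition corners : seq (plane * plane * plane) :=
  [:: (- vvec, 0, - uvec); (0, - uvec, - vvec); (- uvec, - vvec, 0)].

(* In the last family, a^-1 = x a y a z gives a^-1 (y' - z) a = x a y a y' a, and
   a y' a = (- x') a^-1 (- z') by another triangle; the excluded case y' = z is
   the cancellation of a^-1 a. *)
Definition rules : seq (seq sletter * seq sletter) :=
  [:: ([:: inl 0], [::]); ([:: la; la'], [::]); ([:: la'; la], [::])]
  ++ [seq ([:: inl x; inl y], opt (x + y)) | x <- planes, y <- planes]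
  ++ [seq (la :: opt t.1.2 ++ [:: la], opt (- t.1.1) ++ la' :: opt (- t.2))
     | t <- corners]
  ++ [seq (la' :: opt (- t.1.2) ++ [:: la'], opt t.2 ++ la :: opt t.1.1)
     | t <- corners]
  ++ [seq (la' :: opt (p.2.1.2 - p.1.2) ++ [:: la],
           opt p.1.1.1 ++ la :: opt (p.1.1.2 - p.2.1.1) ++ la' :: opt (- p.2.2))
     | p <- [seq p <- [seq (s, t) | s <- corners, t <- corners]
            | p.2.1.2 - p.1.2 != 0]].

(* Interpreting letters as affine functions proves termination; the constants
   are chosen so that every rule strictly decreases the interpretation. *)
Definition affine (l : sletter) : nat * nat :=
  match l with inl _ => (1, 1) | inr true => (2, 11) | inr false => (2, 5) end%N.

Definition weight (w : seq sletter) (x : nat) : nat :=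
  foldr (fun l m => (affine l).1 * m + (affine l).2)%N x w.

Definition weight_coefs (w : seq sletter) : nat * nat :=
  foldr (fun l p => ((affine l).1 * p.1, (affine l).1 * p.2 + (affine l).2)%N)
    (1, 0)%N w.

Lemma weightE w x : weight w x = ((weight_coefs w).1 * x + (weight_coefs w).2)%N.
Proof.
by elim: w => [|l w /= ->]; rewrite /= ?mul1n ?addn0 // mulnDr mulnA addnA.
Qed.

Lemma weight_ltn w x y : (x < y)%N -> (weight w x < weight w y)%N.
Proof.
move=> lt; elim: w => //= l w IH; rewrite ltn_add2r ltn_pmul2l //.
by case: l => [?|[]].
Qed.

Lemma weight_decreasing x r y : r \in rules ->
  (weight (x ++ r.2 ++ y) 0 < weight (x ++ r.1 ++ y) 0)%N.
Proof.
(* The prefix [x] acts by a strictly increasing map, so it suffices to compare the affine functions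
   of the two sides of the rule coefficientwise. *)
move=> hr; rewrite /weight !foldr_cat; apply: weight_ltn.
rewrite -!/(weight _ _) !weightE.
have /allP/(_ _ hr)/andP[c1 c2] : all (fun r =>
    ((weight_coefs r.2).1 <= (weight_coefs r.1).1)
    && ((weight_coefs r.2).2 < (weight_coefs r.1).2))%N rules by vm_compute.
by rewrite -addnS; apply: leq_add; rewrite ?leq_mul.
Qed.

Lemma rules_locally_confluent : locally_confluent rules 6.
Proof. by vm_compute. Qed.

Lemma rules_lhs_size : all (fun r => 0 < size r.1 <= 3)%N rules.
Proof. by vm_compute. Qed.
End TriangleSystem.

(** * Words in a and b as paths: infinite order of a, and a free pair *)

Section Interpretation.
Local Open Scope group_scope.

Local Notation "w1 <~> w2" := (joinable rules w1 w2) (at level 70).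

Let jtrans := joinable_trans weight_decreasing rules_locally_confluent.
Let jcat := joinable_cat weight_decreasing rules_locally_confluent.
Let jsym := @joinable_sym _ rules.
Let jrefl := @joinable_refl _ rules.

Lemma multiplicativeX (G H : groupType) (f : {multiplicative G -> H}) n x :
  f (x ^+ n) = f x ^+ n.
Proof. by elim: n => [|n IH]; rewrite ?multiplicative1 // !expgS gmulfM IH. Qed.

Definition tr_letter (l : letter gens) : seq sletter :=
  match l with
  | (gen_a, true) => [:: la]
  | (gen_a, false) => [:: la']
  | (gen_b, true) => [:: inl uvec; la']
  | (gen_b, false) => [:: la; inl (- uvec)%R]
  end.

Definition tr (w : seq (letter gens)) : seq sletter := flatten (map tr_letter w).

Lemma tr_reduce w : tr (reduce w) <~> tr w.
Proof.
elim: w => [|l w IH]; first exact: jrefl.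
have {IH} h : tr (l :: reduce w) <~> tr (l :: w) by apply: jcat => //; apply: jrefl.
apply: jtrans h; rewrite [reduce _]/=; case: (reduce w) => [|l' w'] /=.
  exact: jrefl.
case: eqP => [->|_]; last exact: jrefl.
rewrite /tr /= catA -[X in X <~> _]cat0s; apply: jcat; last exact: jrefl.
by case: l => [] [] [] /=; apply: (@joinable_normalize _ rules 6); vm_compute.
Qed.

Lemma tr_mul (x y : free_group gens) : tr (x * y) <~> tr x ++ tr y.
Proof. by rewrite /tr -flatten_cat -map_cat; apply: tr_reduce. Qed.

(** Joinability is a congruence by confluence, so only the three relators need computation. *)
Lemma tr_normal_closure x : normal_closure rels x -> tr x <~> [::].
Proof.
have trV (y : free_group gens) : tr (y^-1 : free_group gens) ++ tr y <~> [::].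
  by apply: jtrans (jsym (tr_mul _ _)) _; rewrite mulVg; apply: jrefl.
elim=> {x} [x|||x hx|g x hx].
- by case=> ->; apply: (@joinable_normalize _ rules 40); vm_compute.
- exact: jrefl.
- by move=> x y _ hx _ hy; apply: jtrans (tr_mul _ _) _; apply: jcat hx hy.
- move=> ih; rewrite -[tr _]cats0; apply: jtrans (trV x).
  by apply: jcat (jsym ih); apply: jrefl.
- move=> ih; apply: jtrans (tr_mul _ _) _.
  have h : tr (g * x) <~> tr g.
    apply: jtrans (tr_mul _ _) _; rewrite -[X in _ <~> X]cats0.
    by apply: jcat ih; apply: jrefl.
  apply: jtrans (jcat h (jrefl _)) _.
  by have := trV g^-1; rewrite invgK.
Qed.

Lemma tr_ker x : gproj rels x = 1 -> tr x <~> [::].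
Proof. by move/gprojP; rewrite invg1 mulg1; apply: tr_normal_closure. Qed.

Definition block : seq sletter :=
  [:: la'; inl (uvec + vvec)%R; la'; inl (uvec + vvec)%R; la'; inl (uvec + vvec)%R].

(* a^6 = v (a^-1 u v)^3 v^-1 *)
Lemma tr_a6 n : tr ((fgen gen_a ^+ 6) ^+ n) <~>
  inl vvec :: flatten (nseq n block) ++ [:: inl (- vvec)%R].
Proof.
elim: n => [|n IH].
  by apply: (@joinable_normalize _ rules 6); vm_compute.
rewrite expgS; apply: jtrans (tr_mul _ _) _; apply: jtrans (jcat (jrefl _) IH) _.
set F := flatten (nseq n block).
rewrite -[inl vvec :: F ++ _]cat1s catA.
rewrite -[inl vvec :: flatten _ ++ _]/((inl vvec :: block) ++ F ++ [:: inl (- vvec)%R]).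
apply: jcat (jrefl _).
by apply: (@joinable_normalize _ rules 60); vm_compute.
Qed.

Lemma block_irreducible n : irreducible_word rules (flatten (nseq n block)).
Proof.
apply: (is_irreducibleP rules_lhs_size).
elim: n => [|[_|n]]; [by [] | by vm_compute |].
rewrite -[flatten (nseq n.+2 _)]/(block ++ block ++ flatten (nseq n block)).
rewrite -[flatten (nseq n.+1 _)]/(block ++ flatten (nseq n block)).
move: (flatten (nseq n block)) => F IH.
(* The windows starting in the first block end inside the second, so [F] stays abstract. *)
do 6 (apply/andP; split; first by vm_compute).
exact: IH.
Qed.

Lemma infinite_order_pgen_a : infinite_order (pgen rels gen_a).
Proof.
move=> n n_gt0 an1.
have {an1} : gproj rels ((fgen gen_a ^+ 6) ^+ n) = 1.
  by rewrite -expgM mulnC expgM !multiplicativeX an1 expg1n.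
move/tr_ker/(jtrans (jsym (tr_a6 n))) => h.
set F := flatten _ in h.
(* Cancel the conjugation by v. *)
have : F <~> [::].
  have vV : [:: inl (- vvec)%R; inl vvec] <~> [::].
    by apply: (@joinable_normalize _ rules 6); vm_compute.
  have := jcat (jrefl [:: inl (- vvec)%R]) (jcat h (jrefl [:: inl vvec])).
  rewrite /= -catA => h1; apply: (jtrans (jtrans _ h1) vV).
  rewrite -[X in X <~> _]cats0 -[X in X <~> _]cat0s -[X in _ <~> X]/([:: _; _] ++ (F ++ _)).
  by apply: jcat (jsym vV) _; apply: jcat (jrefl _) (jsym vV).
move/(joinable_irreducible (@block_irreducible n) (@block_irreducible 0)).
by rewrite {h}/F; case: n n_gt0.
Qed.

(* The letters of F(p, q), with p = a u = a b a and q = u v a v, written in the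
   form x a^(+-1) y. *)
Definition syllable (l : letter bool) : plane * sletter * plane :=
  match l with
  | (true, true) => (0, la, uvec)
  | (true, false) => (- uvec, la', 0)
  | (false, true) => (uvec + vvec, la, vvec)
  | (false, false) => (- vvec, la', - (uvec + vvec))
  end%R.

Definition sform (l : letter bool) : seq sletter :=
  opt (syllable l).1.1 ++ (syllable l).1.2 :: opt (syllable l).2.

(** Adjacent plane letters are merged and the leading one is dropped; a merged letter is zero only
    between cancelling syllables. *)
Fixpoint free_form (l : letter bool) (w : seq (letter bool)) : seq sletter :=
  (syllable l).1.2 ::
    if w is l' :: w' then
      inl ((syllable l).2 + (syllable l').1.1)%R :: free_form l' w'
    else opt (syllable l).2.

Lemma free_formE l w :
  flatten (map sform (l :: w)) <~> opt (syllable l).1.1 ++ free_form l w.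
Proof.
elim: w l => [|l' w IH] l; first by rewrite /= cats0; apply: jrefl.
rewrite [flatten _]/= -/(flatten (map sform (l' :: w))).
apply: jtrans (jcat (jrefl _) (IH l')) _.
rewrite /sform -catA cat_cons; apply: jcat; first exact: jrefl.
rewrite /= -cat1s -[X in _ <~> X]cat1s; apply: jcat; first exact: jrefl.
rewrite catA -[X in _ <~> X]cat1s; apply: jcat; last exact: jrefl.
by case: l l' {IH} => [] [] [] [] [] []; apply: (@joinable_normalize _ rules 6); vm_compute.
Qed.

(** In a reduced word the merged letter avoids 0, -u, -v between two a, avoids 0, u, v between two
    a^-1, and is u + v or -(u + v) in a^-1 ... a, where no flip applies. *)
Lemma free_form_irreducible l w :
  reduced (l :: w) -> irreducible_word rules (free_form l w).
Proof.
move=> hw; apply: (is_irreducibleP rules_lhs_size); elim: w l hw => [|l' w IH] l.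
  by case: l => [] [] [] _; vm_compute.
move=> /andP[ll' /IH {}IH]; case: w IH => [|l'' w] IH.
  by case: l l' ll' {IH} => [] [] [] [] [] [] //; vm_compute.
(* The windows at the first syllable and at the plane letter after it are decided by [l] and [l']
   alone. *)
apply/andP; split.
  by case: l l' ll' {IH} => [] [] [] [] [] [] // _; rewrite /= take0; vm_compute.
apply/andP; split=> //.
by case: l l' ll' {IH} => [] [] [] [] [] [] // _; rewrite /= take0; vm_compute.
Qed.

Definition free_pair (x : bool) : free_group gens :=
  let a := fgen gen_a in let b := fgen gen_b in
  if x then a * b * a else b * a * (a * b^-1 * a) * a * (a * b^-1 * a).

Lemma tr_flift (w : seq (letter bool)) :
  tr (weval free_pair w) <~> flatten (map sform w).
Proof.
elim: w => [|l w IH]; first exact: jrefl.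
apply: jtrans (tr_mul _ _) _; apply: jcat IH.
by case: l => [] [] []; apply: (@joinable_normalize _ rules 60); vm_compute.
Qed.

Lemma free_pair_ker (w : free_group bool) :
  gproj rels (flift free_pair w) = 1 -> w = 1.
Proof.
case: w => -[|l w] hw /tr_ker; first by move=> _; apply: val_inj.
move/(jtrans (jsym (tr_flift _)))/(jtrans (jsym (free_formE _ _))).
move/(jcat (jrefl (opt (- (syllable l).1.1)%R))); rewrite catA cats0 => h.
have {h} : free_form l w <~> opt (- (syllable l).1.1)%R.
  apply: jtrans h; rewrite -[X in X <~> _]cat0s; apply: jcat; last exact: jrefl.
  by case: l {hw} => [] [] []; apply: (@joinable_normalize _ rules 6); vm_compute.
move/joinable_irreducible => h; exfalso.
(* Both sides are normal forms, but the left one starts with a or a^-1 and the right one contains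
   neither. *)
have : free_form l w = opt (- (syllable l).1.1)%R.
  apply: h; first exact: free_form_irreducible.
  apply: (is_irreducibleP rules_lhs_size).
  by case: l {hw} => [] [] []; vm_compute.
by case: l {h hw} => [] [] []; case: w.
Qed.
End Interpretation.

(** * The relations as affinity of two triples of values *)

Lemma affine_triples_conj (H : groupType) (a p0 p1 p2 : H) :
  (exists t, [/\ a * p1 * a^-1 = t * (a * p0 * a^-1),
                 a * p2 * a^-1 = t * (a * p1 * a^-1)
               & a * p0 * a^-1 = t * (a * p2 * a^-1)])
  <-> exists t, [/\ p1 = t * p0, p2 = t * p1 & p0 = t * p2].
Proof.
have conjI x y : a * x * a^-1 = a * y * a^-1 -> x = y by move/mulIg/mulgI.
split=> -[t]; last first.
  move=> [h1 h2 h3]; exists (a * t * a^-1).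
  by split; rewrite !mulgA mulgVK -(mulgA a t) -?h1 -?h2 -?h3.
have e p : t * (a * p * a^-1) = a * (a^-1 * t * a * p) * a^-1.
  by rewrite !mulgA mulgV mul1g.
by rewrite !e => -[/conjI h1 /conjI h2 /conjI h3]; exists (a^-1 * t * a).
Qed.

Lemma affine_triplesP (H : groupType) (u v : H) :
  (exists t, [/\ u^-1 * v = t * v^-1, u = t * (u^-1 * v) & v^-1 = t * u]) /\
  (exists t, [/\ v = t * u^-1, u * v^-1 = t * v & u^-1 = t * (u * v^-1)])
  <-> [/\ u ^+ 3 = 1, v ^+ 3 = 1 & comm u v = 1].
Proof.
have cube (x : H) : x ^+ 3 = x * x * x by rewrite !expgS mulg1 mulgA.
rewrite !cube /comm; split=> [[[s [s1 _ s3]] [t [t1 t2 t3]]]|[u3 v3 uv]].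
  have {s1} es : s = u^-1 * v * v by rewrite s1 mulgVK.
  have {t1} et : t = v * u by rewrite {1}t1 mulgVK.
  rewrite {s}es in s3; rewrite {t}et in t2 t3.
  have vJ : u^-1 * v * u = v^-1 * v^-1.
    apply: (mulgI u); rewrite !mulgA mulgV mul1g t2.
    by rewrite -[RHS]mulgA mulgV mulg1.
  (* Squaring [vJ] and comparing with [s3] gives v^-1 = v^-4. *)
  have v3 : v * v * v = 1.
    have h : v^-1 = v^-1 * v^-1 * (v^-1 * v^-1).
      by rewrite -vJ !mulgA mulgK -s3.
    apply: (mulgI (v^-1 * v^-1 * (v^-1 * v^-1))).
    by rewrite mulg1 -{2}h !mulgA !mulgVK.
  have vv : v^-1 * v^-1 = v.
    by apply: (mulIg v); rewrite mulgVK; apply: (mulIg v); rewrite mulVg.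
  have c : v * u = u * v by apply: (mulgI u^-1); rewrite mulKg mulgA vJ vv.
  split=> //; last by rewrite -c mulgK mulgV.
  have -> : u * u = u^-1 by rewrite t3 mulgA c -(mulgA u v u) c mulgA mulgK.
  exact: mulVg.
have c : u * v = v * u by move/divg1_eq: uv => /(canRL (mulgVK _)).
have uu : u * u = u^-1 by apply: (mulIg u); rewrite mulVg.
have vv : v * v = v^-1 by apply: (mulIg v); rewrite mulVg.
have uu' : u^-1 * u^-1 = u by apply: (mulgI u); rewrite mulVKg uu.
have c' : u^-1 * v^-1 = v^-1 * u^-1 by rewrite -!invgM c.
have c'' : v * u^-1 = u^-1 * v by apply: (mulgI u); rewrite mulgA c mulgK mulVKg.
(* Each ratio is forced by the first equation of its triple. *)
split; [exists (u^-1 * v * v) | exists (v * u)]; split.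
- by rewrite mulgK.
- by rewrite -(mulgA u^-1) vv c' mulgA -(mulgA v^-1) uu' -mulgA c mulKg.
- by rewrite -(mulgA u^-1) vv c' mulgVK.
- by rewrite mulgK.
- by rewrite -c -(mulgA u) vv.
- by rewrite mulgA -(mulgA v) uu c'' mulgK.
Qed.

(** * Cubic maps on the cyclic group of order 3 *)

Section CubicMaps.
Local Open Scope group_scope.
Variables (C3 : finGroupType) (sigma : C3).
Hypotheses (C3_cyclic : [set: C3] = <[sigma]>) (order_sigma : #[sigma] = 3).

Lemma C3_elements g : [\/ g = 1, g = sigma | g = sigma ^+ 2].
Proof.
have /cycleP[i ->] : g \in <[sigma]> by rewrite -C3_cyclic inE.
rewrite -expg_mod_order order_sigma; have := ltn_pmod i (isT : 0 < 3)%N.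
by case: (i %% 3) => [|[|[|]]] // _; [constructor 1 | constructor 2 | constructor 3].
Qed.

Lemma C3_mul :
  [/\ sigma * sigma = sigma ^+ 2, sigma * sigma ^+ 2 = 1,
      sigma ^+ 2 * sigma = 1 & sigma ^+ 2 * sigma ^+ 2 = sigma].
Proof.
have s3 : sigma ^+ 3 = 1 by rewrite -order_sigma expg_order.
by rewrite -expgS -expgSr -expgD s3; split=> //; rewrite expgS s3 mulg1.
Qed.

Variable H : groupType.

(** Shifting by [sigma ^+ j] multiplies by [t ^+ j], so the generator decides. *)
Lemma polynomial_lt2P (chi : C3 -> H) :
  polynomial_lt 2 chi <-> exists t, forall g, chi (sigma * g) = t * chi g.
Proof.
split=> [h | [t ht] k k' g].
  exists (fdiff sigma chi 1) => g; apply/(canRL (mulgVK _)).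
  by have /divg1_eq := h sigma g 1; rewrite /fdiff !mulg1.
have /cycleP[i ->] : k \in <[sigma]> by rewrite -C3_cyclic inE.
have e j x : chi (sigma ^+ j * x) = t ^+ j * chi x.
  by elim: j => [|j IH]; rewrite ?mul1g // !expgS -!mulgA ht IH.
by rewrite /fdiff !e !mulgK mulgV.
Qed.

Lemma polynomial_lt2_valuesP (chi : C3 -> H) : polynomial_lt 2 chi <->
  exists t, [/\ chi sigma = t * chi 1, chi (sigma ^+ 2) = t * chi sigma
              & chi 1 = t * chi (sigma ^+ 2)].
Proof.
have [m1 m2 _ _] := C3_mul; rewrite polynomial_lt2P.
split=> -[t ht]; exists t; first by split; rewrite -ht ?mulg1 ?m1 ?m2.
by case: ht => h1 h2 h3 g; case: (C3_elements g) => ->; rewrite ?mulg1 ?m1 ?m2.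
Qed.

(* The difference by sigma^2 is the pointwise inverse of a translate of the
   difference by sigma, and these operations preserve affine maps. *)
Lemma polynomial_lt3P (psi : C3 -> H) :
  polynomial_lt 3 psi <-> polynomial_lt 2 (fdiff sigma psi).
Proof.
have [m1 m2 m3 m4] := C3_mul.
split=> [h|h k]; first exact: (h sigma).
case: (C3_elements k) => -> //.
  apply/polynomial_lt2P; exists 1 => g; rewrite /fdiff !mul1g !mulgV //.
move/polynomial_lt2_valuesP: h => [t [h1 h2 h3]]; apply/polynomial_lt2_valuesP.
have e g : fdiff (sigma ^+ 2) psi g = (fdiff sigma psi (sigma ^+ 2 * g))^-1.
  by rewrite /fdiff mulgA m2 mul1g invgM invgK.
set x := fdiff sigma psi 1 in h1 h3 *.
have t3 : t * t * t = 1 by apply: (mulIg x); rewrite -!mulgA -h1 -h2 -h3 mul1g.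
have tt : t * t = t^-1 by apply: (mulIg t); rewrite mulVg.
(* The values at 1, sigma, sigma^2 are (t^2 x)^-1, x^-1, (t x)^-1; the witness is the ratio of the
   first two. *)
exists (x^-1 * (t * t) * x); rewrite !e mulg1 m3 m4 h2 h1 -/x; clearbody x; split.
- by rewrite !invgM !mulgA !mulgK.
- by rewrite tt invgM mulgK.
- by rewrite tt !invgM !mulgA mulgK.
Qed.

Lemma cubicP (phi : C3 -> H) : unital phi ->
  let a := phi sigma in let b := phi (sigma ^+ 2) in
  cubic phi <->
  [/\ (b * a) ^+ 3 = 1, (a * b^-1 * a) ^+ 3 = 1 & comm (b * a) (a * b^-1 * a) = 1].
Proof.
move=> phi1 a b; have [m1 m2 m3 m4] := C3_mul.
have cubicE : cubic phi <-> polynomial_lt 4 phi.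
  by split=> [[n le]|]; [apply: polynomial_lt_leq | exists 4].
have {cubicE}-> : cubic phi <-> polynomial_lt 2 (fdiff sigma (fdiff sigma phi)) /\
    polynomial_lt 2 (fdiff sigma (fdiff (sigma ^+ 2) phi)).
  split=> [/cubicE h|[h1 h2]]; first by split; apply/polynomial_lt3P; apply: h.
  apply/cubicE => k; case: (C3_elements k) => ->; first last.
  - exact/polynomial_lt3P.
  - exact/polynomial_lt3P.
  by apply: (polynomial_lt_leq (leq0n 3)) => g; rewrite /fdiff mul1g mulgV.
rewrite !polynomial_lt2_valuesP /fdiff !mulg1 m1 m2 m3 m4 !mulg1 phi1 -/a -/b.
have : b = (b * a) * a^-1 by rewrite mulgK.
move: (b * a) => u -> {b}; set v := a * _ * a.
have vE : v = a * a * u^-1 * a by rewrite /v invgM invgK mulgA.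
clearbody v.
(* It remains to match the values of the two second differences with the triples in a, u, v. *)
rewrite -affine_triplesP -(affine_triples_conj a v^-1 (u^-1 * v) u).
rewrite invg1 !mul1g !mulg1 !invgM !invgK.
have vV : v^-1 = a^-1 * u * a^-1 * a^-1.
  by rewrite vE !invgM !invgK !mulgA.
have -> : u * a^-1 * a^-1 * a^-1 = a * v^-1 * a^-1.
  by rewrite vV !mulgA mulgV mul1g.
have -> : a * u^-1 * (a * (a * u^-1)) = a * (u^-1 * v) * a^-1.
  by rewrite vE !mulgA mulgK.
have -> : a * (u * a^-1) = a * u * a^-1 by rewrite mulgA.
have -> : a * (a * u^-1) * a = v by rewrite vE mulgA.
have -> : a^-1 * (a * u^-1) = u^-1 by rewrite mulKg.
have -> // : u * a^-1 * (u * a^-1 * a^-1) = u * v^-1.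
by rewrite vV !mulgA.
Qed.
End CubicMaps.

(** * Comparing the two universal properties *)

Section Presentations.
Local Open Scope group_scope.

Definition hom_of (G H : groupType) (f : G -> H) (fM : {morph f : x y / x * y}) :
    {multiplicative G -> H} :=
  HB.pack_for {multiplicative G -> H} f (isMultiplicative.Build _ _ f fM).

Lemma gproj_rel (G : groupType) (R : G -> Prop) r : R r -> gproj R r = 1.
Proof. by move=> hr; apply/gprojP; rewrite invg1 mulg1; apply: ncl_rel. Qed.

Lemma presented_lift (X : choiceType) (R : free_group X -> Prop) (H : groupType)
    (h : X -> H) : (forall r, R r -> flift h r = 1) ->
  exists f : {multiplicative presented R -> H}, forall x, f (pgen R x) = h x.
Proof.
move=> hR; pose F : {multiplicative free_group X -> H} := flift h.
have Fker w : normal_closure R w -> F w = 1.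
  elim=> {w} [y /hR //||y z _ hy _ hz|y _ hy|g y _ hy].
  - exact: multiplicative1.
  - by rewrite gmulfM hy hz mulg1.
  - by rewrite multiplicativeV hy invg1.
  - by rewrite !gmulfM multiplicativeV hy mulg1 mulgV.
have fE x : F (grepr (gproj R x)) = F x.
  have := Fker _ (grepr_gproj R x).
  by rewrite gmulfM multiplicativeV => /divg1_eq.
have fM : {morph (fun x : presented R => F (grepr x)) : x y / x * y}.
  by move=> x y; rewrite -(greprK x) -(greprK y) -gmulfM !fE gmulfM.
by exists (hom_of fM) => x; rewrite /= fE; apply: flift_gen.
Qed.

Lemma presented_ext (X : choiceType) (R : free_group X -> Prop) (H : groupType)
    (f g : {multiplicative presented R -> H}) :
  (forall x, f (pgen R x) = g (pgen R x)) -> f =1 g.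
Proof.
move=> e x; rewrite -(greprK x).
pose c (k : {multiplicative presented R -> H}) := hom_of (comp_gmulfM k (gproj R)).
exact: (@free_group_ext _ _ (c f) (c g)).
Qed.

Lemma injective_hom (G H : groupType) (f : {multiplicative G -> H}) :
  (forall x, f x = 1 -> x = 1) -> injective f.
Proof.
move=> ker x y e; apply/divg1_eq/ker.
by rewrite gmulfM multiplicativeV e mulgV.
Qed.

Lemma presented_rels :
  let a := pgen rels gen_a in let b := pgen rels gen_b in
  [/\ (b * a) ^+ 3 = 1, (a * b^-1 * a) ^+ 3 = 1 & comm (b * a) (a * b^-1 * a) = 1].
Proof.
pose p : {multiplicative free_group gens -> presented rels} := gproj rels.
pose a := fgen gen_a; pose b := fgen gen_b.
have ba : p (b * a) = pgen rels gen_b * pgen rels gen_a by rewrite gmulfM.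
have aba : p (a * b^-1 * a) =
    pgen rels gen_a * (pgen rels gen_b)^-1 * pgen rels gen_a.
  by rewrite !gmulfM multiplicativeV.
rewrite /= -ba -aba; split.
- by rewrite -multiplicativeX; apply: gproj_rel; constructor 1.
- by rewrite -multiplicativeX; apply: gproj_rel; constructor 2.
- have := @gproj_rel _ rels _ (Or33 _ _ (erefl (comm (b * a) (a * b^-1 * a)))).
  by rewrite -/(p _) /comm !(gmulfM _ _^-1) (gmulfM (b * a)) !multiplicativeV.
Qed.

Variables (C3 : finGroupType) (sigma : C3).
Hypotheses (C3_cyclic : [set: C3] = <[sigma]>) (order_sigma : #[sigma] = 3).
Variables (Pol3 : groupType) (phi : C3 -> Pol3).
Hypothesis phi_universal : universal_unital_cubic phi.

Lemma presentation : exists f : {multiplicative presented rels -> Pol3},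
  [/\ bijective f, f (pgen rels gen_a) = phi sigma
    & f (pgen rels gen_b) = phi (sigma ^+ 2)].
Proof.
have [phi1 phi3 univ] := phi_universal.
pose h x := if x is gen_a then phi sigma else phi (sigma ^+ 2).
have [r|F Fgen] := @presented_lift _ rels _ h.
  have [r1 r2 r3] := (cubicP C3_cyclic order_sigma phi1).1 phi3.
  pose E : {multiplicative free_group gens -> Pol3} := flift h.
  have Ea : E (fgen gen_a) = phi sigma by apply: flift_gen.
  have Eb : E (fgen gen_b) = phi (sigma ^+ 2) by apply: flift_gen.
  rewrite -/(E r) /comm => -[]->.
  - by rewrite multiplicativeX gmulfM Ea Eb.
  - by rewrite multiplicativeX !gmulfM multiplicativeV Ea Eb.
  - by rewrite !gmulfM !multiplicativeV !gmulfM multiplicativeV Ea Eb.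
exists F; split; [|exact: Fgen|exact: Fgen].
(* The inverse of [F] is induced by the map 1, sigma, sigma^2 to 1, a, b, which is cubic by the
   relators. *)
pose alpha g := if g == 1 then 1 else
  pgen rels (if g == sigma then gen_a else gen_b).
have s1 : sigma != 1 by rewrite -order_eq1 order_sigma.
have s2 : sigma ^+ 2 != 1.
  apply: contraNneq s1 => s2; have [_ _ + _] := C3_mul order_sigma.
  by rewrite s2 mul1g => ->.
have alpha1 : unital alpha by rewrite /unital /alpha eqxx.
have alphas : alpha sigma = pgen rels gen_a.
  by rewrite /alpha (negbTE s1) eqxx.
have alphat : alpha (sigma ^+ 2) = pgen rels gen_b.
  rewrite /alpha (negbTE s2).
  by rewrite -{2}[sigma]mulg1 expgS (inj_eq (mulgI _)) (negbTE s1).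
have alpha3 : cubic alpha.
  apply/(cubicP C3_cyclic order_sigma alpha1); rewrite alphas alphat.
  exact: presented_rels.
have [G Gphi _] := univ _ _ alpha1 alpha3.
have [I _ Iuniq] := univ _ _ phi1 phi3.
exists G => x.
  pose GF := hom_of (comp_gmulfM G F).
  have idM : {morph (fun x : presented rels => x) : x y / x * y} by [].
  apply: (@presented_ext _ _ _ GF (hom_of idM)) => -[] /=; rewrite Fgen.
    by rewrite -alphas Gphi.
  by rewrite -alphat Gphi.
pose FG := hom_of (comp_gmulfM F G).
have idM : {morph (fun x : Pol3 => x) : x y / x * y} by [].
(* The identity and [FG] both factor [phi] through itself, so both equal [I]. *)
rewrite -[RHS]/(hom_of idM x) (Iuniq (hom_of idM)) //.
apply: (Iuniq FG) => g /=; rewrite -[G _]Gphi.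
case: (C3_elements C3_cyclic order_sigma g) => ->.
- by rewrite alpha1 phi1 multiplicative1.
- by rewrite alphas Fgen.
- by rewrite alphat Fgen.
Qed.

Lemma infinite_order_phi : infinite_order (phi sigma).
Proof.
have [f [/bij_inj finj fa _]] := presentation.
move=> n n_gt0 an1; apply: (infinite_order_pgen_a n_gt0); apply: finj.
by rewrite multiplicativeX fa an1 multiplicative1.
Qed.

Lemma contains_nonabelian_free_Pol3 : contains_nonabelian_free Pol3.
Proof.
have [f [/bij_inj finj _ _]] := presentation.
pose g := hom_of (comp_gmulfM (gproj rels) (flift free_pair)).
pose k := hom_of (comp_gmulfM f g).
have kinj : injective k.
  apply: injective_hom => x /= fx; apply: free_pair_ker; apply: finj.
  by rewrite fx multiplicative1.
exists bool, k; split=> //; exists (fgen true), (fgen false).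
by rewrite -!gmulfM => /kinj/(congr1 (@fword _)).
Qed.
End Presentations.

Theorem theorem1 (C3 : finGroupType) (sigma : C3)
    (C3_cyclic : [set: C3] = <[sigma]>) (order_sigma : #[sigma] = 3)
    (Pol3 : groupType) (phi : C3 -> Pol3)
    (phi_universal : universal_unital_cubic phi) :
  let tau := sigma ^+ 2 in
  [/\ exists f : {multiplicative presented rels -> Pol3},
        [/\ bijective f, f (pgen rels gen_a) = phi sigma
          & f (pgen rels gen_b) = phi tau],
      infinite_order (phi sigma),
      infinite_order (phi tau)
    & contains_nonabelian_free Pol3].
Proof.
(* [tau] is another generator of order 3, so the infinite order proved for the image of a generator
   applies to it too. *)
move=> tau; have order_tau : #[tau] = 3 by rewrite orderXgcd order_sigma.
have tau_gen : [set: C3] = <[tau]>.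
  apply/esym/eqP; rewrite eqEcard subsetT C3_cyclic.
  by rewrite -!orderE order_tau order_sigma.
split; first exact: presentation.
- exact: (infinite_order_phi C3_cyclic order_sigma phi_universal).
- exact: (infinite_order_phi tau_gen order_tau phi_universal).
- exact: (contains_nonabelian_free_Pol3 C3_cyclic order_sigma phi_universal).
Qed.
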